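(* For real $\nu$ and $x>0$ let $p=\nu/\sqrt{\nu^2+x^2}$ and $$c_{\pm}(\nu,p)=\frac{2\nu\pm(1+2p+p^2)}{2\nu\pm(1+2p-p^2)}.$$ Then for all $\nu\ge 0$ and $x>0$ $$x\frac{I_{\nu-1}(x)}{I_\nu(x)}<\nu-\frac{(1+p)^2}{2}+\sqrt{\left(\nu+\frac{(1+p)^2}{2}\right)^2+c_+(\nu,p)\,x^2},$$ and for all $\nu\ge 2$ and $x>0$ $$x\frac{K_{\nu+1}(x)}{K_\nu(x)}>\nu+\frac{(1+p)^2}{2}+\sqrt{\left(\nu-\frac{(1+p)^2}{2}\right)^2+c_-(\nu,p)\,x^2}.$$
   Context: $I_\nu(x)$ and $K_\nu(x)$ denote the modified Bessel functions of the first and second kind, of real order $\nu$ and real argument $x>0$. *)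

(* Defs.v *)
From Stdlib Require Export Reals Factorial.
From Coquelicot Require Export Coquelicot.
Open Scope R_scope.

(* Euler's integral; meaningful for [0 < s]. *)
Definition Gamma (s : R) : R :=
  RInt_gen (fun t => Rpower t (s - 1) * exp (- t))
           (at_right 0) (Rbar_locally p_infty).

Fixpoint rising (s : R) (n : nat) : R :=
  match n with
  | O => 1
  | S m => rising s m * (s + INR m)
  end.

(* The entire function 1/Gamma at an arbitrary real [s], continued through
   1 / Gamma s = s (s+1) ... (s+n-1) / Gamma (s+n), where
   n := max(0, up (- s)) is the least natural number with [0 < s + n].
   In particular it vanishes at s = 0, -1, -2, ... *)
Definition rGamma (s : R) : R :=
  let n := Z.to_nat (up (- s)) in rising s n / Gamma (s + INR n).

(* I_nu(x) = sum_k (x/2)^(2k+nu) / (k! Gamma(nu+k+1)), for 0 < x. *)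
Definition besselI (nu x : R) : R :=
  Series (fun k : nat =>
    Rpower (x / 2) (2 * INR k + nu) * rGamma (nu + INR k + 1) / INR (fact k)).

(* K_nu(x) = int_0^oo exp(- x cosh t) cosh(nu t) dt, for 0 < x;
   it covers integer and non-integer real orders uniformly. *)
Definition besselK (nu x : R) : R :=
  RInt_gen (fun t => exp (- x * cosh t) * cosh (nu * t))
           (at_point 0) (Rbar_locally p_infty).

Definition p_of (nu x : R) : R := nu / sqrt (nu ^ 2 + x ^ 2).

Definition c_plus (nu p : R) : R :=
  (2 * nu + (1 + 2 * p + p ^ 2)) / (2 * nu + (1 + 2 * p - p ^ 2)).

Definition c_minus (nu p : R) : R :=
  (2 * nu - (1 + 2 * p + p ^ 2)) / (2 * nu - (1 + 2 * p - p ^ 2)).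

(* Main.v *)
Require Import Defs.
From Stdlib Require Import Reals Lra Lia Psatz.
From Coquelicot Require Import Coquelicot.
Open Scope R_scope.

(* Write u = x I_nu'/I_nu and v = - x K_nu'/K_nu, so that the two ratios are nu + u and nu + v, with
   x u' = nu^2 + x^2 - u^2 and x v' = v^2 - nu^2 - x^2. Freeze p as a constant, put a = (1+p)^2/2 and
   let b be the bound minus nu, i.e. b = r -+ a with r = sqrt (m^2 + c x^2) and m = nu +- a. Then b
   solves the same Riccati equation up to the defect (r - m) (p r - m)^2 / (m r) >= 0: the
   coefficients a and c are exactly those making the defect a perfect square. Hence u < b by
   comparison from x = 0, and v > b by comparison from infinity (where v > 0 rules out the
   exponentially decreasing differences v - b). This holds for every fixed p in [0, 1); the choice
   p = nu / sqrt (nu^2 + x^2) only has to avoid the point p r = m where the defect vanishes. *)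

(** The bound is wanted at one point [x0], so [p] can be given its value there and kept constant
    along the whole comparison; a varying [p] would contribute its own derivative and destroy the
    square. The comparison by itself yields only a weak inequality. Strictness is decided at [x0]:
    if the bound were attained there, the derivative of the difference would be the defect alone, up
    to sign and a positive factor. So [p r <> m] is required at the end point and nowhere else. The
    two ends differ. The [I] side runs in [z = (x/2)^2], where the ratio is a quotient of entire
    functions, hence continuous at the left end, and both compared functions start from [nu]. The
    [K] side needs no asymptotics of [K]: the bound grows only linearly, and this already
    contradicts an exponential decrease. *)

(* [A] is the set of admissible left endpoints: [{0}] for the Bessel integral, [(0, 1]] for Euler's. *)
Lemma is_RInt_gen_nonneg (Fa : (R -> Prop) -> Prop) (A : R -> Prop) (f : R -> R) (M : R) :
  Filter Fa ->
  (exists a, A a) ->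
  (forall a0, A a0 -> Fa (fun a => A a /\ a <= a0)) ->
  (forall a, A a -> a <= 1) ->
  (forall a t, A a -> a <= t -> continuous f t) ->
  (forall a t, A a -> a <= t -> 0 <= f t) ->
  (forall a b, A a -> 1 <= b -> RInt f a b <= M) ->
  exists l, is_RInt_gen f Fa (Rbar_locally p_infty) l /\
    forall a b, A a -> 1 <= b -> RInt f a b <= l.
Proof.
intros HF [a1 Ha1] HFa HA1 Hc Hp HM.
assert (Hex : forall a b c, A a -> a <= b -> a <= c -> ex_RInt f b c).
{ intros a b c Ha Hb Hcc. apply (ex_RInt_continuous (V := R_CompleteNormedModule)).
  intros z [Hz _]. apply (Hc a); auto.
  apply Rle_trans with (2 := Hz). apply Rmin_glb; auto. }
assert (Hmono : forall a a' b b', A a -> A a' -> a' <= a -> 1 <= b -> b <= b' ->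
   RInt f a b <= RInt f a' b').
{ intros a a' b b' Ha Ha' Haa Hb Hbb. pose proof (HA1 a Ha) as H1.
  assert (E : RInt f a' b' = RInt f a' a + RInt f a b + RInt f b b').
  { rewrite <- (RInt_Chasles f a' a b'), <- (RInt_Chasles f a b b').
    unfold plus; simpl; ring.
    all: apply (Hex a'); auto; lra. }
  assert (0 <= RInt f a' a).
  { apply RInt_ge_0; auto. apply (Hex a'); auto; lra. intros; apply (Hp a'); auto; lra. }
  assert (0 <= RInt f b b').
  { apply RInt_ge_0; auto. apply (Hex a'); auto; lra. intros; apply (Hp a'); auto; lra. }
  lra. }
(* By monotonicity in both end points, the supremum of the proper integrals is their limit; it also
   bounds each of them, which later gives strict positivity. *)
destruct (completeness (fun y => exists a b, A a /\ 1 <= b /\ y = RInt f a b)) as [l [Hub Hl]].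
{ exists M. intros y (a & b & Ha & Hb & ->). auto. }
{ exists (RInt f a1 1), a1, 1. repeat split; auto; lra. }
exists l; split.
2:{ intros a b Ha Hb. apply Hub. exists a, b; auto. }
intros P [eps HP].
assert (exists a0 b0, A a0 /\ 1 <= b0 /\ l - eps < RInt f a0 b0) as (a0 & b0 & Ha0 & Hb0 & Hlt).
{ apply Classical_Prop.NNPP. intros Hn.
  assert (l <= l - eps).
  { apply Hl. intros y (a & b & Ha & Hb & ->).
    destruct (Rle_lt_dec (RInt f a b) (l - eps)) as [h|h]; auto.
    exfalso; apply Hn; exists a, b; auto. }
  pose proof (cond_pos eps). lra. }
unfold filtermapi.
exists (fun a => A a /\ a <= a0) (fun b => b0 <= b).
- apply HFa; auto.
- exists b0. intros; lra.
- intros a b [Ha Hal] Hb. simpl. exists (RInt f a b). split.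
  + apply (RInt_correct (V := R_CompleteNormedModule)). apply (Hex a); auto. lra.
    pose proof (HA1 a Ha); lra.
  + apply HP. unfold ball; simpl; unfold AbsRing_ball, abs, minus, plus, opp; simpl.
    assert (RInt f a b <= l) by (apply Hub; exists a, b; repeat split; auto; lra).
    assert (RInt f a0 b0 <= RInt f a b) by (apply Hmono; auto).
    apply Rabs_def1; lra.
Qed.

(** Supplies the boundary terms of the integrations by parts. [P] is the domain where the primitive
    is smooth: the positive half-line for Euler's integral, the whole line for the kernel
    [exp (- x * cosh t)]. *)
Lemma is_RInt_gen_derivative (Fa Fb : (R -> Prop) -> Prop) (P : R -> Prop) (f df : R -> R) (la lb : R) :
  Filter Fa -> Filter Fb ->
  filter_prod Fa Fb (fun ab => forall x, fst ab <= x <= snd ab -> P x) ->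
  filter_prod Fa Fb (fun ab => fst ab <= snd ab) ->
  (forall x, P x -> is_derive f x (df x)) ->
  (forall x, P x -> continuous df x) ->
  filterlim f Fa (locally la) -> filterlim f Fb (locally lb) ->
  is_RInt_gen df Fa Fb (lb - la).
Proof.
intros HFa HFb HP Hle Hd Hc Hla Hlb.
intros Q HQ.
assert (L : filterlim (fun ab : R * R => f (snd ab) - f (fst ab)) (filter_prod Fa Fb)
   (locally (lb - la))).
{ assert (La : filterlim (fun ab : R * R => opp (f (fst ab))) (filter_prod Fa Fb) (locally (opp la))).
  { apply (filterlim_comp _ _ _ (fun ab : R * R => f (fst ab)) opp _ (locally la)).
    - apply (filterlim_comp _ _ _ fst f _ Fa); auto. apply filterlim_fst.
    - apply (filterlim_opp (K := R_AbsRing) (V := R_NormedModule)). }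
  assert (Lb : filterlim (fun ab : R * R => f (snd ab)) (filter_prod Fa Fb) (locally lb)).
  { apply (filterlim_comp _ _ _ snd f _ Fb); auto. apply filterlim_snd. }
  apply (filterlim_comp_2 (H := locally (opp la)) (fun ab : R * R => f (snd ab)) (fun ab => opp (f (fst ab))) plus Lb La).
  apply (filterlim_plus (K := R_AbsRing) (V := R_NormedModule)). }
specialize (L Q HQ). unfold filtermap in L. unfold filtermapi.
generalize (filter_and _ _ L (filter_and _ _ HP Hle)).
apply filter_imp. intros [a b] (HL & HPx & Hab); simpl in *.
exists (f b - f a). split; auto.
apply (is_RInt_derive f df a b); intros x Hx; rewrite Rmin_left, Rmax_right in Hx by auto; auto.
Qed.

(** The gap between the two sides has a derivative equal to [n] times the preceding gap, and it is
    nonnegative at 0. All tail estimates below rest on this bound. *)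
Lemma pow_le_fact_exp (n : nat) (y : R) : 0 <= y -> y ^ n <= INR (fact n) * exp y.
Proof.
intros Hy. revert y Hy. induction n as [|n IH]; intros y Hy.
- simpl. rewrite Rmult_1_l. pose proof (exp_ineq1_le y). lra.
- destruct (Req_dec y 0) as [->|Hn].
  { rewrite pow_i by lia. apply Rmult_le_pos. apply pos_INR. left; apply exp_pos. }
  destruct (MVT_gen (fun t => INR (fact (S n)) * exp t - t ^ (S n)) 0 y
     (fun t => INR (fact (S n)) * exp t - INR (S n) * t ^ n)) as (c & Hc & E).
  + intros t _. auto_derive; trivial.
    change (INR (fact (S n)) * (1 * exp t) + - (1 * (INR (S n) * t ^ n))
      = INR (fact (S n)) * exp t - INR (S n) * t ^ n). ring.
  + intros t _. apply continuity_pt_filterlim.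
    apply (ex_derive_continuous (fun t => INR (fact (S n)) * exp t - t ^ (S n))). auto_derive; auto.
  + rewrite Rmin_left, Rmax_right in Hc by auto.
    rewrite pow_i, exp_0 in E by lia.
    specialize (IH c (proj1 Hc)).
    rewrite fact_simpl, mult_INR in *.
    pose proof (lt_0_INR (S n) ltac:(lia)) as HS.
    assert (0 <= (INR (S n) * INR (fact n) * exp c - INR (S n) * c ^ n) * (y - 0)).
    { apply Rmult_le_pos; [|lra].
      replace (INR (S n) * INR (fact n) * exp c - INR (S n) * c ^ n)
        with (INR (S n) * (INR (fact n) * exp c - c ^ n)) by ring.
      apply Rmult_le_pos; lra. }
    assert (0 <= INR (S n) * INR (fact n)).
    { apply Rmult_le_pos; apply pos_INR. }
    lra.
Qed.

(** * Euler's integral *)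

Definition gamma_integrand (s t : R) : R := Rpower t (s - 1) * exp (- t).

Lemma Rpower_pred_exp (s t : R) : 0 < t -> exp ((s - 1) * ln t) = exp (s * ln t) / t.
Proof.
intros Ht. replace ((s - 1) * ln t) with (s * ln t + - ln t) by ring.
rewrite exp_plus, exp_Ropp, exp_ln by auto. reflexivity.
Qed.

Lemma continuous_gamma_integrand (s t : R) : 0 < t -> continuous (gamma_integrand s) t.
Proof.
intros Ht. apply (ex_derive_continuous (gamma_integrand s)). unfold gamma_integrand, Rpower.
auto_derive. auto.
Qed.

Lemma gamma_integrand_pos (s t : R) : 0 < gamma_integrand s t.
Proof. apply Rmult_lt_0_compat; apply exp_pos. Qed.

Lemma Rpower_exp_le (s : R) :
  exists C, 0 < C /\ forall t, 1 <= t -> Rpower t s * exp (- t) <= C * exp (- (t / 2)).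
Proof.
(* For [t >= 1] the power is at most [t^N = 2^N (t/2)^N <= 2^N N! exp (t/2)], which uses up only
   half of the exponential decay. *)
destruct (INR_unbounded s) as [N HN].
exists (INR (fact N) * 2 ^ N). split.
{ apply Rmult_lt_0_compat. apply INR_fact_lt_0. apply pow_lt; lra. }
intros t Ht.
assert (H1 : Rpower t s <= t ^ N).
{ rewrite <- Rpower_pow by lra. apply Rle_Rpower; lra. }
pose proof (pow_le_fact_exp N (t / 2) ltac:(lra)) as H2.
assert (H3 : t ^ N = 2 ^ N * (t / 2) ^ N) by (rewrite <- Rpow_mult_distr; f_equal; field).
replace (exp (- t)) with (exp (- (t / 2)) * exp (- (t / 2))) by (rewrite <- exp_plus; f_equal; field).
rewrite <- Rmult_assoc. apply Rmult_le_compat_r. left; apply exp_pos.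
apply Rmult_le_reg_r with (exp (t / 2)). apply exp_pos.
rewrite Rmult_assoc, <- exp_plus. replace (- (t / 2) + t / 2) with 0 by ring.
rewrite exp_0, Rmult_1_r. rewrite H3 in H1.
pose proof (pow_lt 2 N ltac:(lra)). nra.
Qed.

Lemma RInt_gamma_bound (s : R) : 0 < s ->
  exists M, forall a b, 0 < a <= 1 -> 1 <= b -> RInt (gamma_integrand s) a b <= M.
Proof.
intros Hs. destruct (Rpower_exp_le (s - 1)) as (C & HC & HCle).
(* [1 / s] is the integral of [t^(s-1)] over (0, 1], and [2 * C] bounds the integral of
   [C * exp (- (t / 2))] over [1, oo). *)
exists (1 / s + 2 * C). intros a b Ha Hb.
assert (Hex : forall u v, 0 < u -> 0 < v -> ex_RInt (gamma_integrand s) u v).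
{ intros u v Hu Hv. apply (ex_RInt_continuous (V := R_CompleteNormedModule)). intros z [Hz _].
  apply continuous_gamma_integrand. apply Rlt_le_trans with (2 := Hz). apply Rmin_glb_lt; auto. }
rewrite <- (RInt_Chasles (gamma_integrand s) a 1 b) by (apply Hex; lra).
unfold plus; simpl. apply Rplus_le_compat.
- assert (I : is_RInt (fun t => Rpower t (s - 1)) a 1 (1 / s - Rpower a s / s)).
  { replace (1 / s) with (Rpower 1 s / s).
    2:{ unfold Rpower. rewrite ln_1, Rmult_0_r, exp_0. reflexivity. }
    apply (is_RInt_derive (fun t => Rpower t s / s) (fun t => Rpower t (s - 1)));
      intros t Ht; rewrite Rmin_left, Rmax_right in Ht by lra.
    - unfold Rpower. auto_derive. lra.
      rewrite Rpower_pred_exp by lra. field. lra.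
    - apply (ex_derive_continuous (fun t => Rpower t (s - 1))). unfold Rpower. auto_derive. lra. }
  apply Rle_trans with (1 / s - Rpower a s / s).
  + rewrite <- (is_RInt_unique _ _ _ _ I). apply RInt_le. lra. apply Hex; lra. eexists; exact I.
    intros t Ht. unfold gamma_integrand. rewrite <- Rmult_1_r. apply Rmult_le_compat_l.
    left; apply exp_pos. rewrite <- exp_0. left. apply exp_increasing. lra.
  + assert (0 < Rpower a s / s) by (apply Rdiv_lt_0_compat; auto; apply exp_pos). lra.
- assert (I : is_RInt (fun t => C * exp (- (t / 2))) 1 b (- 2 * C * exp (- (b / 2)) - - 2 * C * exp (- (1 / 2)))).
  { apply (is_RInt_derive (fun t => - 2 * C * exp (- (t / 2)))); intros t Ht.
    - auto_derive; auto. unfold Rdiv; field.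
    - apply (ex_derive_continuous (fun t => C * exp (- (t / 2)))). auto_derive; auto. }
  apply Rle_trans with (- 2 * C * exp (- (b / 2)) - - 2 * C * exp (- (1 / 2))).
  + rewrite <- (is_RInt_unique _ _ _ _ I). apply RInt_le. lra. apply Hex; lra. eexists; exact I.
    intros t Ht. apply HCle; lra.
  + pose proof (exp_pos (- (b / 2))).
    assert (Hh : exp (- (1 / 2)) < exp 0) by (apply exp_increasing; lra).
    rewrite exp_0 in Hh. nra.
Qed.

Lemma at_right_0_le (a0 : R) : 0 < a0 <= 1 -> at_right 0 (fun a => 0 < a <= 1 /\ a <= a0).
Proof.
intros Ha. exists (mkposreal a0 (proj1 Ha)). intros y Hy Hy0.
unfold ball in Hy; simpl in Hy; unfold AbsRing_ball, abs, minus, plus, opp in Hy; simpl in Hy.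
apply Rabs_def2 in Hy. lra.
Qed.

Lemma Gamma_correct (s : R) : 0 < s ->
  is_RInt_gen (gamma_integrand s) (at_right 0) (Rbar_locally p_infty) (Gamma s) /\ 0 < Gamma s.
Proof.
intros Hs. destruct (RInt_gamma_bound s Hs) as [M HM].
destruct (is_RInt_gen_nonneg (at_right 0) (fun a => 0 < a <= 1) (gamma_integrand s) M) as (l & Hl & Hle).
- apply at_right_proper_filter.
- exists 1; lra.
- intros a0 Ha. apply at_right_0_le; auto.
- intros; lra.
- intros a t Ha Ht. apply continuous_gamma_integrand. lra.
- intros; left; apply gamma_integrand_pos.
- exact HM.
- assert (E : Gamma s = l) by (apply is_RInt_gen_unique; exact Hl).
  rewrite E. split; auto.
  apply Rlt_le_trans with (2 := Hle 1 2 ltac:(lra) ltac:(lra)).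
  apply RInt_gt_0. lra. intros; apply gamma_integrand_pos.
  intros; apply continuous_gamma_integrand; lra.
Qed.

Lemma filterlim_Rpower_exp_0 (s : R) : 0 < s ->
  filterlim (fun t => Rpower t s * exp (- t)) (at_right 0) (locally 0).
Proof.
intros Hs P [eps HP].
(* The radius [eps^(1/s)] is where [t^s] reaches [eps]; the exponential factor is below 1. *)
assert (Hd : 0 < Rpower eps (/ s)) by apply exp_pos.
exists (mkposreal _ Hd). intros t Ht Ht0.
unfold ball in Ht; simpl in Ht; unfold AbsRing_ball, abs, minus, plus, opp in Ht; simpl in Ht.
apply Rabs_def2 in Ht. apply HP.
unfold ball; simpl; unfold AbsRing_ball, abs, minus, plus, opp; simpl.
rewrite Ropp_0, Rplus_0_r, Rabs_pos_eq.
2:{ left; apply Rmult_lt_0_compat; apply exp_pos. }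
assert (Rpower t s < eps).
{ replace (pos eps) with (Rpower (Rpower eps (/ s)) s).
  apply Rlt_Rpower_l; lra.
  rewrite Rpower_mult, Rinv_l, Rpower_1 by (try lra; apply cond_pos). reflexivity. }
assert (exp (- t) < 1) by (rewrite <- exp_0; apply exp_increasing; lra).
assert (0 < Rpower t s) by apply exp_pos. nra.
Qed.

Lemma filterlim_squeeze_0 (f g : R -> R) (b : R) :
  (forall t, b < t -> 0 <= f t <= g t) ->
  is_lim g p_infty 0 -> filterlim f (Rbar_locally p_infty) (locally 0).
Proof.
intros H Hg. apply (is_lim_le_le_loc (fun _ => 0) g f p_infty 0).
- exists b. exact H.
- apply is_lim_const.
- exact Hg.
Qed.

Lemma filterlim_Rpower_exp_infty (s : R) :
  filterlim (fun t => Rpower t s * exp (- t)) (Rbar_locally p_infty) (locally 0).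
Proof.
destruct (Rpower_exp_le s) as (C & HC & HCle).
apply filterlim_squeeze_0 with (fun t => C * exp (- (t / 2))) 1.
- intros t Ht. split. left; apply Rmult_lt_0_compat; apply exp_pos. apply HCle; lra.
- replace (Finite 0) with (Rbar_mult C 0) by (simpl; f_equal; ring).
  apply is_lim_scal_l.
  apply is_lim_ext with (fun t => exp ((- / 2) * t + 0)). intros; f_equal; field.
  apply is_lim_comp_lin with (a := - / 2) (b := 0) (f := exp) (x := p_infty); [|lra].
  replace (Rbar_plus (Rbar_mult (- / 2) p_infty) 0) with m_infty. apply is_lim_exp_m.
  simpl. destruct Rle_dec as [h|h]; [exfalso; lra|reflexivity].
Qed.

(** The difference of the two integrands is the derivative of [t^s exp (- t)], which tends to 0 at
    both ends. *)
Lemma Gamma_succ (s : R) : 0 < s -> Gamma (s + 1) = s * Gamma s.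
Proof.
intros Hs.
destruct (Gamma_correct s Hs) as [H0 _].
apply is_RInt_gen_unique.
assert (H1 : is_RInt_gen (fun t => s * gamma_integrand s t - gamma_integrand (s + 1) t)
  (at_right 0) (Rbar_locally p_infty) (0 - 0)).
{ apply is_RInt_gen_derivative with (P := fun x => 0 < x) (f := fun t => Rpower t s * exp (- t)).
  - apply at_right_proper_filter.
  - apply Rbar_locally_filter.
  - exists (fun a => 0 < a <= 1 /\ a <= 1) (fun b => 1 <= b). apply at_right_0_le; lra.
    exists 1; intros; lra. simpl; intros; lra.
  - exists (fun a => 0 < a <= 1 /\ a <= 1) (fun b => 1 <= b). apply at_right_0_le; lra.
    exists 1; intros; lra. simpl; intros; lra.
  - intros t Ht. unfold gamma_integrand. replace (s + 1 - 1) with s by ring.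
    unfold Rpower. auto_derive. lra. rewrite Rpower_pred_exp by lra. field. lra.
  - intros t Ht. apply (continuous_minus (fun t => s * gamma_integrand s t)).
    apply (continuous_mult (fun _ => s) (gamma_integrand s)). apply continuous_const.
    apply continuous_gamma_integrand; auto.
    apply continuous_gamma_integrand; auto.
  - apply filterlim_Rpower_exp_0; auto.
  - apply filterlim_Rpower_exp_infty. }
evar_last.
- eapply is_RInt_gen_ext; [|exact (is_RInt_gen_minus _ _ _ _ (is_RInt_gen_scal _ s _ H0) H1)].
  exists (fun _ => True) (fun _ => True). apply filter_true. apply filter_true.
  intros a b _ _ t _. unfold minus, plus, opp, scal; simpl; unfold mult, gamma_integrand; simpl. ring.
- unfold minus, plus, opp, scal; simpl; unfold mult; simpl; ring.
Qed.

Lemma rGamma_pos_arg (s : R) : 0 < s -> rGamma s = / Gamma s.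
Proof.
intros Hs. unfold rGamma. destruct (archimed (- s)) as [_ H].
(* [Z.to_nat] truncates a nonpositive integer to 0, so no recurrence shift takes place for positive
   [s]. *)
assert (up (- s) <= 0)%Z.
{ apply Z.lt_succ_r, lt_IZR. simpl. lra. }
replace (Z.to_nat (up (- s))) with 0%nat by lia. simpl. rewrite Rplus_0_r. unfold Rdiv; ring.
Qed.

(** The value [s = 0] has to be included: it is the leading coefficient of [I_(nu-1)] when
    [nu = 0]. *)
Lemma rGamma_succ (s : R) : 0 <= s -> rGamma s = s * rGamma (s + 1).
Proof.
intros [Hs|<-].
- rewrite !rGamma_pos_arg by lra. rewrite Gamma_succ by auto.
  destruct (Gamma_correct s Hs). field. lra.
(* [up] is strictly above its argument, so [up 0 = 1] and the single factor of [rising 0 1] is 0. *)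
- unfold rGamma at 1. rewrite Ropp_0. rewrite <- (tech_up 0 1) by (simpl; lra).
  simpl. unfold Rdiv; ring.
Qed.

Lemma rGamma_gt_0 (s : R) : 0 < s -> 0 < rGamma s.
Proof.
intros Hs. rewrite rGamma_pos_arg by auto. apply Rinv_0_lt_compat, Gamma_correct, Hs.
Qed.

(** * Comparison arguments *)

Lemma decreasing_to_left (w : R -> R) (m l lo : R) :
  is_derive w m l -> 0 < l -> lo < m -> exists y, lo < y < m /\ w y < w m.
Proof.
intros Hd Hl Hlo. apply is_derive_Reals in Hd.
destruct (Hd l Hl) as [d Hd'].
pose proof (cond_pos d) as Hdp.
(* Halving both distances keeps the step strictly inside the radius [d] and strictly to the right of
   [lo]. *)
set (h := - Rmin (d / 2) ((m - lo) / 2)).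
assert (Hh : 0 < - h <= d / 2 /\ - h <= (m - lo) / 2).
{ unfold h. rewrite Ropp_involutive. repeat split.
  apply Rmin_glb_lt; lra. apply Rmin_l. apply Rmin_r. }
specialize (Hd' h ltac:(lra)).
rewrite Rabs_left in Hd' by lra. specialize (Hd' ltac:(lra)).
apply Rabs_def2 in Hd'. exists (m + h). split. lra.
assert (E : w (m + h) - w m = (w (m + h) - w m) / h * h) by (field; lra).
nra.
Qed.

Lemma decreasing_to_right (w : R -> R) (m l hi : R) :
  is_derive w m l -> l < 0 -> m < hi -> exists y, m < y < hi /\ w y < w m.
Proof.
intros Hd Hl Hhi.
destruct (decreasing_to_left (fun y => w (- y)) (- m) (- l) (- hi)) as (y & Hy & H).
- replace (- l) with (scal (- (1)) l) by (unfold scal; simpl; unfold mult; simpl; ring).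
  apply (is_derive_comp w Ropp).
  + rewrite Ropp_involutive. exact Hd.
  + auto_derive; auto.
- lra.
- lra.
- exists (- y). rewrite Ropp_involutive in H. split; [lra|exact H].
Qed.

(* A negative minimum on [0, z0] would have points with smaller values on its left. *)
Lemma positive_from_zero (w dw : R -> R) (z0 : R) :
  0 < z0 -> 0 <= w 0 ->
  (forall z, 0 <= z <= z0 -> continuous w z) ->
  (forall z, 0 < z <= z0 -> is_derive w z (dw z)) ->
  (forall z, 0 < z <= z0 -> w z < 0 -> 0 < dw z) ->
  (w z0 = 0 -> 0 < dw z0) -> 0 < w z0.
Proof.
intros Hz0 Hw0 Hc Hd Hneg Hz.
assert (K : forall z, 0 < z <= z0 -> 0 <= w z).
{ intros z Hz1. apply Rnot_lt_le. intros Hw.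
  destruct (continuity_ab_min w 0 z) as (m & Hm & Hmz). lra.
  { intros c Hcz. apply continuity_pt_filterlim. apply Hc. lra. }
  assert (Hwm : w m < 0) by (apply Rle_lt_trans with (w z); auto; apply Hm; lra).
  assert (m <> 0) by (intros ->; lra).
  destruct (decreasing_to_left w m (dw m) 0) as (y & Hy & Hlt).
  - apply Hd; lra.
  - apply Hneg; lra.
  - lra.
  - specialize (Hm y ltac:(lra)). lra. }
(* If [w z0 = 0], then [z0] minimizes the nonnegative [w], yet the positive slope there gives
   smaller values on its left. *)
destruct (K z0 ltac:(lra)) as [H|H]; auto.
destruct (decreasing_to_left w z0 (dw z0) 0) as (y & Hy & Hlt); auto.
apply Hd; lra.
specialize (K y ltac:(lra)). lra.
Qed.

(** The minimum over the interval is negative, so the slope there is negative and smaller values lie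
    to its right; the minimum can only be at [X]. *)
Lemma nonincreasing_once_negative (w dw : R -> R) (x1 X : R) :
  x1 <= X ->
  (forall x, x1 <= x <= X -> is_derive w x (dw x)) ->
  (forall x, x1 <= x <= X -> w x < 0 -> dw x < 0) ->
  w x1 < 0 -> w X <= w x1.
Proof.
intros HX Hd Hneg Hw.
destruct (continuity_ab_min w x1 X) as (m & Hm & Hmz). lra.
{ intros c Hc. apply continuity_pt_filterlim, (ex_derive_continuous w). eexists; apply Hd; lra. }
destruct (proj2 Hmz) as [Hlt|E].
- destruct (decreasing_to_right w m (dw m) X) as (y & Hy & H).
  + apply Hd; lra.
  + apply Hneg; [lra|]. apply Rle_lt_trans with (w x1); auto. apply Hm; lra.
  + lra.
  + specialize (Hm y ltac:(lra)). lra.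
- rewrite <- E. apply Hm. lra.
Qed.

(* Once negative, [w] would decrease exponentially. *)
Lemma positive_from_infinity (w dw : R -> R) (x0 k N : R) :
  0 < x0 -> 0 < k ->
  (forall x, x0 <= x -> is_derive w x (dw x)) ->
  (forall x, x0 <= x -> w x < 0 -> dw x <= k * w x) ->
  (forall x, x0 <= x -> - (N + N * x) <= w x) ->
  (w x0 = 0 -> dw x0 < 0) -> 0 < w x0.
Proof.
intros Hx0 Hk Hd Hneg Hlow Hz.
assert (K : forall x, x0 <= x -> 0 <= w x).
{ intros x1 Hx1. apply Rnot_lt_le. intros Hw.
  assert (H1 : forall x, x1 <= x -> w x < 0).
  { intros x Hx. apply Rle_lt_trans with (2 := Hw).
    apply nonincreasing_once_negative with dw; auto.
    - intros; apply Hd; lra.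
    - intros y Hy Hwy. specialize (Hneg y ltac:(lra) Hwy). nra. }
  (* Gronwall's argument: [w t * exp (- k * (t - x1))] has a nonpositive derivative while [w] is
     negative. *)
  assert (H2 : forall x, x1 <= x -> w x <= w x1 * exp (k * (x - x1))).
  { intros x Hx.
    destruct (MVT_gen (fun t => w t * exp (- k * (t - x1))) x1 x
      (fun t => (dw t - k * w t) * exp (- k * (t - x1)))) as (c & Hc & E).
    - intros t Ht. rewrite Rmin_left, Rmax_right in Ht by lra.
      specialize (Hd t ltac:(lra)). auto_derive.
      + eexists; exact Hd.
      + replace (Derive (fun x => w x) t) with (dw t) by (symmetry; apply is_derive_unique; exact Hd).
        unfold Rminus; ring.
    - intros t Ht. rewrite Rmin_left, Rmax_right in Ht by lra.
      apply continuity_pt_filterlim.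
      apply (continuous_mult w (fun t => exp (- k * (t - x1)))).
      apply (ex_derive_continuous w). eexists; apply Hd; lra.
      apply (ex_derive_continuous (fun t => exp (- k * (t - x1)))). auto_derive; auto.
    - rewrite Rmin_left, Rmax_right in Hc by lra.
      specialize (Hneg c ltac:(lra) (H1 c ltac:(lra))).
      rewrite Rminus_diag, Rmult_0_r, exp_0, Rmult_1_r in E.
      pose proof (exp_pos (- k * (c - x1))).
      assert (0 <= (k * w c - dw c) * exp (- k * (c - x1)) * (x - x1))
        by (repeat apply Rmult_le_pos; lra).
      assert (w x * exp (- k * (x - x1)) <= w x1) by lra.
      replace (w x) with (w x * exp (- k * (x - x1)) * exp (k * (x - x1))).
      + apply Rmult_le_compat_r; auto. left; apply exp_pos.
      + rewrite Rmult_assoc, <- exp_plus. replace (- k * (x - x1) + k * (x - x1)) with 0 by ring.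
        rewrite exp_0; ring. }
  (* By [exp (k y) >= (k y)^2 / 2], the decrease over a distance [y] brings [w] below [- q y^2]. *)
  set (q := - w x1 * k ^ 2 / 2).
  assert (Hq : 0 < q) by (unfold q; assert (0 < k ^ 2) by (apply pow_lt; auto); nra).
  set (N' := Rabs N).
  assert (HN : 0 <= N' /\ N <= N') by (split; [apply Rabs_pos|apply Rle_abs]).
  set (T := N' + N' * x1).
  assert (HT : 0 <= T) by (unfold T; nra).
  (* The linear lower bound at [x1 + y] is at least [- (T + N' y)]. With this [y >= 1],
     [q y^2 = (q + T + N') y] exceeds [T + N' y]. *)
  set (y := 1 + (T + N') / q).
  assert (Hy : 1 <= y) by (unfold y; assert (0 <= (T + N') / q) by (apply Rdiv_le_0_compat; lra); lra).
  assert (Hqy : q * y = q + T + N') by (unfold y; field; lra).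
  specialize (H2 (x1 + y) ltac:(lra)). specialize (Hlow (x1 + y) ltac:(lra)).
  replace (x1 + y - x1) with y in H2 by ring.
  pose proof (pow_le_fact_exp 2 (k * y) ltac:(nra)) as He. simpl INR in He.
  assert (w x1 * exp (k * y) <= - (q * y * y)).
  { unfold q. simpl in He. nra. }
  unfold T in *. nra. }
destruct (K x0 ltac:(lra)) as [H|H]; auto.
destruct (decreasing_to_right w x0 (dw x0) (x0 + 1)) as (y & Hy & Hlt); auto.
apply Hd; lra. lra.
specialize (K y ltac:(lra)). lra.
Qed.

(** [X] is [x^2] solved from [r^2 = m^2 + c x^2] with [c = m / (m - p^2)], and [(r^2 - m^2) / r] is
    [x] times the derivative of [r]. Once [x] and [nu = m - a] are eliminated, the identity is
    rational in [m], [p] and [r]. *)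
Lemma riccati_defect_plus (a m p r X : R) :
  0 < m -> 0 < r -> 2 * a = (1 + p) ^ 2 -> X = (r ^ 2 - m ^ 2) * (m - p ^ 2) / m ->
  (r ^ 2 - m ^ 2) / r - ((m - a) ^ 2 + X) + (r - a) ^ 2 = (r - m) * (p * r - m) ^ 2 / (m * r).
Proof.
intros Hm Hr Ha ->. replace a with ((1 + p) ^ 2 / 2) by lra. field. lra.
Qed.

(** The preceding identity at [m = - n] with [- r] for [r], all signs changed; hence the opposite
    sign of [p^2]. *)
Lemma riccati_defect_minus (a n p r X : R) :
  0 < n -> 0 < r -> 2 * a = (1 + p) ^ 2 -> X = (r ^ 2 - n ^ 2) * (n + p ^ 2) / n ->
  (r ^ 2 - n ^ 2) / r - (r + a) ^ 2 + ((n + a) ^ 2 + X) = (r - n) * (p * r - n) ^ 2 / (n * r).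
Proof.
intros Hm Hr Ha ->. replace a with ((1 + p) ^ 2 / 2) by lra. field. lra.
Qed.

(** * The function I *)

(* [besselI nu x = (x/2)^nu * PSeries (coefI nu) (x^2/4)]. *)
Definition coefI (nu : R) (k : nat) : R := rGamma (nu + INR k + 1) / INR (fact k).

Lemma coefI_pos (nu : R) (k : nat) : 0 <= nu -> 0 < coefI nu k.
Proof.
intros Hnu. apply Rdiv_lt_0_compat. apply rGamma_gt_0. pose proof (pos_INR k); lra.
apply INR_fact_lt_0.
Qed.

(** This two-term recurrence is the differential equation read off on coefficients; it also gives
    the ratio test its explicit quotient. *)
Lemma coefI_succ (nu : R) (k : nat) : 0 <= nu ->
  coefI nu k = INR (S k) * (nu + INR (S k)) * coefI nu (S k).
Proof.
intros Hnu. unfold coefI. pose proof (pos_INR k) as Hk.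
rewrite (rGamma_succ (nu + INR k + 1)) by lra.
rewrite fact_simpl, mult_INR.
replace (nu + INR k + 1) with (nu + INR (S k)) by (rewrite S_INR; ring).
pose proof (INR_fact_neq_0 k). pose proof (lt_0_INR (S k) ltac:(lia)).
field. split; auto. lra.
Qed.

Lemma CV_radius_coefI (nu : R) : 0 <= nu -> CV_radius (coefI nu) = p_infty.
Proof.
intros Hnu. apply CV_radius_infinite_DAlembert.
{ intros n. pose proof (coefI_pos nu n Hnu). lra. }
apply is_lim_seq_le_le with (fun _ => 0) (fun n => / INR (S n)).
- intros n. pose proof (coefI_pos nu (S n) Hnu) as H.
  pose proof (lt_0_INR (S n) ltac:(lia)) as HS.
  assert (1 <= INR (S n)) by (rewrite S_INR; pose proof (pos_INR n); lra).
  split. apply Rabs_pos.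
  rewrite (coefI_succ nu n Hnu).
  replace (coefI nu (S n) / (INR (S n) * (nu + INR (S n)) * coefI nu (S n)))
    with (/ (INR (S n) * (nu + INR (S n)))) by (field; lra).
  rewrite Rabs_pos_eq.
  2:{ left; apply Rinv_0_lt_compat. apply Rmult_lt_0_compat; lra. }
  apply Rinv_le_contravar; auto. nra.
- apply is_lim_seq_const.
- apply is_lim_seq_incr_1 with (u := fun n => / INR n).
  replace (Finite 0) with (Rbar_inv p_infty) by reflexivity.
  apply is_lim_seq_inv. apply is_lim_seq_INR. discriminate.
Qed.

Lemma CV_radius_infinite_inside (a : nat -> R) (z : R) :
  CV_radius a = p_infty -> Rbar_lt (Rabs z) (CV_radius a).
Proof. intros ->. exact I. Qed.

Lemma PSeries_nonneg (a : nat -> R) (z : R) :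
  CV_radius a = p_infty -> (forall n, 0 <= a n) -> 0 <= z -> 0 <= PSeries a z.
Proof.
intros Ha Hp Hz. rewrite <- (PSeries_const_0 z). apply Series_le.
- intros n. split. lra. rewrite Rmult_0_l. apply Rmult_le_pos; auto. apply pow_le; auto.
- apply ex_series_Rabs, CV_disk_inside, CV_radius_infinite_inside, Ha.
Qed.

Definition seriesI (nu : R) : R -> R := PSeries (coefI nu).
Definition seriesI' (nu : R) : R -> R := PSeries (PS_derive (coefI nu)).

Section SeriesI.
Variable nu : R.
Hypothesis Hnu : 0 <= nu.

Let f := seriesI nu.
Let f' := seriesI' nu.
Let f'' := PSeries (PS_derive (PS_derive (coefI nu))).

Let cv0 : CV_radius (coefI nu) = p_infty := CV_radius_coefI nu Hnu.
Let cv1 : CV_radius (PS_derive (coefI nu)) = p_infty.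
Proof. rewrite CV_radius_derive. exact cv0. Qed.
Let cv2 : CV_radius (PS_derive (PS_derive (coefI nu))) = p_infty.
Proof. rewrite CV_radius_derive. exact cv1. Qed.

Lemma seriesI_pos (z : R) : 0 <= z -> 0 < f z.
Proof.
intros Hz. unfold f, seriesI. rewrite PSeries_decr_1.
2:{ apply CV_radius_inside, CV_radius_infinite_inside, cv0. }
pose proof (coefI_pos nu 0 Hnu).
assert (0 <= PSeries (PS_decr_1 (coefI nu)) z).
{ apply PSeries_nonneg; auto. rewrite CV_radius_decr_1; auto.
  intros n; left; apply coefI_pos; auto. }
nra.
Qed.

Lemma seriesI'_nonneg (z : R) : 0 <= z -> 0 <= f' z.
Proof.
intros Hz. apply PSeries_nonneg; auto.
intros n. unfold PS_derive. apply Rmult_le_pos. apply pos_INR. left; apply coefI_pos; auto.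
Qed.

Lemma is_derive_seriesI (z : R) : is_derive f z (f' z).
Proof. apply is_derive_PSeries, CV_radius_infinite_inside, cv0. Qed.

Lemma is_derive_seriesI' (z : R) : is_derive f' z (f'' z).
Proof. apply is_derive_PSeries, CV_radius_infinite_inside, cv1. Qed.

(** Coefficientwise, the factor [(n + 1) (nu + n + 1)] of the recurrence splits into [n (n + 1)]
    from [z f''] and [(nu + 1) (n + 1)] from [(nu + 1) f']. *)
Lemma seriesI_ode (z : R) : z * f'' z + (nu + 1) * f' z = f z.
Proof.
unfold f, f', f'', seriesI, seriesI'.
rewrite <- PSeries_incr_1, <- PSeries_scal, <- PSeries_plus.
- apply PSeries_ext. intros n. rewrite (coefI_succ nu n Hnu).
  set (d := PS_derive (coefI nu)).
  change (PS_incr_1 (PS_derive d) n + (nu + 1) * d n = INR (S n) * (nu + INR (S n)) * coefI nu (S n)).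
  destruct n as [|n].
  + unfold d, PS_derive. simpl. change (@zero _) with 0. ring.
  + change (INR (S n) * (INR (S (S n)) * coefI nu (S (S n)))
      + (nu + 1) * (INR (S (S n)) * coefI nu (S (S n)))
      = INR (S (S n)) * (nu + INR (S (S n))) * coefI nu (S (S n))).
    rewrite !S_INR. ring.
- apply ex_pseries_incr_1, CV_radius_inside, CV_radius_infinite_inside, cv2.
- apply ex_pseries_scal. apply Rmult_comm. apply CV_radius_inside, CV_radius_infinite_inside, cv1.
Qed.

Lemma besselI_series (x : R) : 0 < x ->
  besselI nu x = Rpower (x / 2) nu * f ((x / 2) ^ 2).
Proof.
intros Hx. unfold besselI, f, seriesI, PSeries. rewrite <- Series_scal_l.
apply Series_ext. intros k. unfold coefI.
rewrite Rpower_plus, <- pow_mult, <- (Rpower_pow (2 * k)) by lra.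
rewrite mult_INR. replace (INR 2) with 2 by (simpl; ring). unfold Rdiv; ring.
Qed.

(** The recurrence of 1/Gamma multiplies the [k]-th coefficient of order [nu] by [nu + k], and
    multiplication by [k] is [z d/dz]. Thus no series of the possibly negative order [nu - 1] has to
    be studied. *)
Lemma besselI_pred_series (x : R) : 0 < x ->
  besselI (nu - 1) x = Rpower (x / 2) (nu - 1) * (nu * f ((x / 2) ^ 2) + (x / 2) ^ 2 * f' ((x / 2) ^ 2)).
Proof.
intros Hx. set (z := (x / 2) ^ 2).
assert (E : nu * f z + z * f' z = PSeries (PS_plus (PS_scal nu (coefI nu)) (PS_incr_1 (PS_derive (coefI nu)))) z).
{ rewrite PSeries_plus, PSeries_incr_1, PSeries_scal. reflexivity.
  - apply ex_pseries_scal. apply Rmult_comm. apply CV_radius_inside, CV_radius_infinite_inside, cv0.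
  - apply ex_pseries_incr_1, CV_radius_inside, CV_radius_infinite_inside, cv1. }
rewrite E. unfold besselI, PSeries. rewrite <- Series_scal_l.
apply Series_ext. intros k. unfold PS_plus, PS_scal, plus, scal; simpl; unfold mult; simpl.
replace (nu - 1 + INR k + 1) with (nu + INR k) by ring.
pose proof (pos_INR k).
rewrite rGamma_succ by lra.
replace (PS_incr_1 (PS_derive (coefI nu)) k) with (INR k * coefI nu k).
2:{ destruct k; unfold PS_incr_1, PS_derive, zero; simpl; ring. }
unfold z. rewrite Rpower_plus, <- pow_mult, <- (Rpower_pow (2 * k)) by lra.
rewrite mult_INR. replace (INR 2) with 2 by (simpl; ring). unfold coefI, Rdiv; ring.
Qed.

Lemma ratioI_series (x : R) : 0 < x ->
  let z := (x / 2) ^ 2 in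
  x * (besselI (nu - 1) x / besselI nu x) = 2 * nu + 2 * z * f' z / f z.
Proof.
intros Hx z. rewrite besselI_series, besselI_pred_series by auto. fold z.
assert (Hz : 0 < z) by (apply pow_lt; lra).
pose proof (seriesI_pos z ltac:(lra)) as Hf.
replace (Rpower (x / 2) nu) with (Rpower (x / 2) (nu - 1) * (x / 2)).
2:{ rewrite <- (Rpower_1 (x / 2)) at 2 by lra. rewrite <- Rpower_plus. f_equal; ring. }
assert (0 < Rpower (x / 2) (nu - 1)) by apply exp_pos.
unfold f, f' in *.
field. lra.
Qed.

(** With [z = (x/2)^2], [x d/dx] becomes [2 z d/dz] and [x^2] becomes [4 z]; [U] is
    [x I_nu' / I_nu]. *)
Lemma riccatiI (z : R) : 0 < z ->
  let U := fun z => nu + 2 * z * f' z / f z in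
  exists dU, is_derive U z dU /\ 2 * z * dU = nu ^ 2 + 4 * z - U z ^ 2.
Proof.
intros Hz U. pose proof (seriesI_pos z ltac:(lra)) as Hf.
exists (2 * (f' z + z * f'' z) / f z - 2 * z * f' z ^ 2 / f z ^ 2). split.
- unfold U. auto_derive.
  + repeat split. eexists; apply is_derive_seriesI'. eexists; apply is_derive_seriesI. lra.
  + replace (Derive (fun x => f x) z) with (f' z) by (symmetry; apply is_derive_unique, is_derive_seriesI).
    replace (Derive (fun x => f' x) z) with (f'' z) by (symmetry; apply is_derive_unique, is_derive_seriesI').
    field. lra.
- replace (z * f'' z) with (f z - (nu + 1) * f' z) by (rewrite <- seriesI_ode; ring).
  unfold U. field. lra.
Qed.

Lemma ratioI_bound (p x : R) : 0 <= p -> 0 < x ->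
  let a := (1 + p) ^ 2 / 2 in
  let m := nu + a in
  let c := m / (m - p ^ 2) in
  0 < m - p ^ 2 ->
  p * sqrt (m ^ 2 + c * x ^ 2) <> m ->
  x * (besselI (nu - 1) x / besselI nu x) < nu - a + sqrt (m ^ 2 + c * x ^ 2).
Proof.
intros Hp Hx a m c Hmp Hne.
rewrite ratioI_series by auto. set (z0 := (x / 2) ^ 2).
assert (Hz0 : 0 < z0) by (apply pow_lt; lra).
assert (Ha : 0 < a) by (unfold a; nra).
assert (Hm : 0 < m) by (unfold m; lra).
assert (Hc : 0 < c) by (apply Rdiv_lt_0_compat; auto).
set (r := fun z => sqrt (m ^ 2 + 4 * c * z)).
assert (Hr2 : forall z, 0 <= z -> r z ^ 2 = m ^ 2 + 4 * c * z).
{ intros z Hz. unfold r. rewrite pow2_sqrt; auto. nra. }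
assert (Hrm : forall z, 0 < z -> m < r z).
{ intros z Hz. unfold r. rewrite <- (sqrt_pow2 m) at 1 by lra. apply sqrt_lt_1; nra. }
set (U := fun z => nu + 2 * z * f' z / f z).
assert (Er : sqrt (m ^ 2 + c * x ^ 2) = r z0) by (unfold r, z0; f_equal; field).
rewrite Er in *.
set (w := fun z => r z - a - U z).
set (dw := fun z => 2 * c / r z - Derive U z).
assert (HU : forall z, 0 < z -> nu <= U z).
{ intros z Hz. unfold U. pose proof (seriesI_pos z ltac:(lra)). pose proof (seriesI'_nonneg z ltac:(lra)).
  assert (0 <= 2 * z * f' z / f z) by (apply Rdiv_le_0_compat; auto; nra). lra. }
(* Subtracting the two Riccati equations factors the difference of squares as [(b + U) w], where
   [b = r - a]. *)
assert (Hdw : forall z, 0 < z ->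
  2 * z * dw z = (r z - m) * (p * r z - m) ^ 2 / (m * r z) - (r z - a + U z) * w z).
{ intros z Hz. specialize (Hrm z Hz).
  destruct (riccatiI z Hz) as (dU & Hd & E). fold U in Hd, E.
  unfold dw. rewrite (is_derive_unique _ _ _ Hd).
  rewrite <- (riccati_defect_plus a m p (r z) (4 * z)); try lra.
  - replace (2 * z * (2 * c / r z - dU)) with (4 * c * z / r z - 2 * z * dU) by (field; lra).
    rewrite E. rewrite (Hr2 z) by lra. unfold w, m. change (nu + 2 * z * f' z / f z) with (U z). field. fold m. lra.
  - unfold a. field.
  - rewrite Hr2 by lra. unfold c. field. lra. }
enough (0 < w z0) by (unfold w, U in *; lra).
apply positive_from_zero with dw; auto.
- unfold w, U, r. rewrite !Rmult_0_r, Rmult_0_l, Rplus_0_r. rewrite sqrt_pow2 by lra. unfold m, Rdiv; lra.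
- intros z Hz. unfold w.
  apply (continuous_minus (fun z => r z - a) U).
  + apply (continuous_minus r (fun _ => a)); [|apply continuous_const].
    unfold r. apply (ex_derive_continuous (fun z => sqrt (m ^ 2 + 4 * c * z))).
    auto_derive. simpl. assert (0 < m * m) by nra. assert (0 <= c * z) by (apply Rmult_le_pos; lra). nra.
  + pose proof (seriesI_pos z ltac:(lra)).
    apply (ex_derive_continuous U). unfold U. auto_derive.
    repeat split. eexists; apply is_derive_seriesI'. eexists; apply is_derive_seriesI. lra.
- intros z Hz. destruct (riccatiI z ltac:(lra)) as (dU & Hd & E). fold U in Hd.
  unfold w, dw. apply (is_derive_minus (fun z => r z - a) U z (2 * c / r z)).
  + unfold r. auto_derive.
    * simpl. assert (0 < m * m) by nra. assert (0 <= c * z) by (apply Rmult_le_pos; lra). nra.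
    * specialize (Hrm z ltac:(lra)). unfold r in Hrm. simpl in *. field. lra.
  + rewrite (is_derive_unique _ _ _ Hd). exact Hd.
- intros z Hz Hw. specialize (Hdw z ltac:(lra)). specialize (HU z ltac:(lra)).
  specialize (Hrm z ltac:(lra)).
  assert (0 <= (r z - m) * (p * r z - m) ^ 2 / (m * r z)).
  { apply Rdiv_le_0_compat. apply Rmult_le_pos. lra. apply pow2_ge_0. nra. }
  (* Here [r > m = nu + a] and [U >= nu], so [b + U > 2 nu >= 0]; a negative [w] then makes both
     terms of [Hdw] push upwards. *)
  assert (0 < r z - a + U z) by (unfold m in *; lra).
  nra.
- intros Hw. specialize (Hdw z0 Hz0). rewrite Hw in Hdw. specialize (Hrm z0 Hz0).
  assert (0 < (r z0 - m) * (p * r z0 - m) ^ 2 / (m * r z0)).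
  { apply Rdiv_lt_0_compat. apply Rmult_lt_0_compat. lra. apply pow2_gt_0. lra. nra. }
  nra.
Qed.

End SeriesI.

(** * The choice of p and the bound for I *)

Lemma p_of_sqr (nu x : R) : 0 < x -> p_of nu x ^ 2 * (nu ^ 2 + x ^ 2) = nu ^ 2.
Proof.
intros Hx. unfold p_of.
assert (0 < nu ^ 2 + x ^ 2) by nra.
pose proof (sqrt_lt_R0 _ H). rewrite <- (pow2_sqrt (nu ^ 2 + x ^ 2)) at 2 by lra. field. lra.
Qed.

Lemma p_of_bounds (nu x : R) : 0 <= nu -> 0 < x -> 0 <= p_of nu x < 1.
Proof.
intros Hnu Hx. pose proof (p_of_sqr nu x Hx).
assert (0 <= p_of nu x).
{ apply Rdiv_le_0_compat; auto. apply sqrt_lt_R0. nra. }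
split; auto. apply Rnot_le_lt. intros H1.
assert (0 < x ^ 2) by (apply pow_lt; auto). assert (1 <= p_of nu x ^ 2) by nra.
pose proof (pow2_ge_0 nu). nra.
Qed.

(** If [p r = m] held at this [x], eliminating [x^2] would leave [m (m - p^2) = nu^2]. But both
    factors exceed [nu], because [0 <= p^2 < a]. *)
Lemma ratioI_upper (nu x : R) : 0 <= nu -> 0 < x ->
  let p := p_of nu x in
  x * (besselI (nu - 1) x / besselI nu x)
  < nu - (1 + p) ^ 2 / 2 + sqrt ((nu + (1 + p) ^ 2 / 2) ^ 2 + c_plus nu p * x ^ 2).
Proof.
intros Hnu Hx p. pose proof (p_of_bounds nu x Hnu Hx) as Hp. pose proof (p_of_sqr nu x Hx) as Hp2.
fold p in Hp, Hp2.
set (a := (1 + p) ^ 2 / 2).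
assert (Hap : p ^ 2 < a) by (unfold a; nra).
assert (E : c_plus nu p = (nu + a) / (nu + a - p ^ 2)).
{ unfold c_plus, a. unfold a in Hap. field. simpl in *; lra. }
rewrite E. apply ratioI_bound; auto; fold a; try lra.
set (m := nu + a). assert (Hm : 0 < m - p ^ 2) by (unfold m; lra).
assert (Hp2' := pow2_ge_0 p).
intros Ht.
assert (Hs : 0 <= m / (m - p ^ 2) * x ^ 2).
{ apply Rmult_le_pos. apply Rdiv_le_0_compat; lra. apply pow2_ge_0. }
assert (H1 : p ^ 2 * (m ^ 2 + m / (m - p ^ 2) * x ^ 2) = m ^ 2).
{ transitivity ((p * sqrt (m ^ 2 + m / (m - p ^ 2) * x ^ 2)) ^ 2); [|rewrite Ht; reflexivity].
  rewrite Rpow_mult_distr, pow2_sqrt; auto. pose proof (pow2_ge_0 m); lra. }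
assert (H2 : p ^ 2 * x ^ 2 = m * (1 - p ^ 2) * (m - p ^ 2)).
{ apply Rmult_eq_reg_l with (m / (m - p ^ 2)).
  - transitivity (m ^ 2 * (1 - p ^ 2)). lra. field. lra.
  - assert (0 < m / (m - p ^ 2)) by (apply Rdiv_lt_0_compat; lra). lra. }
(* [p_of_sqr] also gives [p^2 x^2 = nu^2 (1 - p^2)], which is compared with [H2]. *)
assert (H3 : (1 - p ^ 2) * (m * (m - p ^ 2) - nu ^ 2) = 0) by lra.
assert (0 < 1 - p ^ 2) by nra.
assert (m * (m - p ^ 2) - nu ^ 2 = 0) by nra.
unfold m in *. nra.
Qed.

(** * The function K *)

(** A class of weights closed under sums and products for which integrals against
    [exp (- x * cosh t)] converge. Nonnegativity reduces convergence to bounded integrals, and the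
    natural exponent [N] lets a power of [exp t] absorb the growth. *)
Definition tame (f : R -> R) : Prop :=
  (forall t, continuous f t) /\ (forall t, 0 <= t -> 0 <= f t) /\
  exists (C : R) (N : nat), 0 <= C /\ forall t, 0 <= t -> f t <= C * exp (INR N * t).

Lemma tame_mult (f g : R -> R) : tame f -> tame g -> tame (fun t => f t * g t).
Proof.
intros (Cf & Pf & C & Nf & HC & Bf) (Cg & Pg & D & Ng & HD & Bg). repeat split.
- intros t. apply (continuous_mult f g); auto.
- intros t Ht. apply Rmult_le_pos; auto.
- exists (C * D), (Nf + Ng)%nat. split. apply Rmult_le_pos; auto.
  intros t Ht. rewrite plus_INR, Rmult_plus_distr_r, exp_plus.
  replace (C * D * (exp (INR Nf * t) * exp (INR Ng * t)))
    with ((C * exp (INR Nf * t)) * (D * exp (INR Ng * t))) by ring.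
  apply Rmult_le_compat; auto.
Qed.

Lemma tame_plus (f g : R -> R) : tame f -> tame g -> tame (fun t => f t + g t).
Proof.
intros (Cf & Pf & C & Nf & HC & Bf) (Cg & Pg & D & Ng & HD & Bg). repeat split.
- intros t. apply (continuous_plus f g); auto.
- intros t Ht. apply Rplus_le_le_0_compat; auto.
- exists (C + D), (Nf + Ng)%nat. split. lra.
  intros t Ht. specialize (Bf t Ht). specialize (Bg t Ht).
  rewrite plus_INR, (Rmult_plus_distr_r (INR Nf)), exp_plus.
  assert (1 <= exp (INR Nf * t)).
  { pose proof (exp_ineq1_le (INR Nf * t)). pose proof (pos_INR Nf). nra. }
  assert (1 <= exp (INR Ng * t)).
  { pose proof (exp_ineq1_le (INR Ng * t)). pose proof (pos_INR Ng). nra. }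
  rewrite Rmult_plus_distr_r. apply Rplus_le_compat.
  + apply Rle_trans with (1 := Bf). apply Rmult_le_compat_l; nra.
  + apply Rle_trans with (1 := Bg). apply Rmult_le_compat_l; nra.
Qed.

Lemma tame_const (c : R) : 0 <= c -> tame (fun _ => c).
Proof.
intros Hc. repeat split; auto.
- intros; apply continuous_const.
- exists c, 0%nat. split; auto. intros t _. simpl. rewrite Rmult_0_l, exp_0. lra.
Qed.

Lemma exp_le_exp (x y : R) : x <= y -> exp x <= exp y.
Proof. intros [H| ->]; [left; apply exp_increasing; auto|lra]. Qed.

Lemma tame_cosh (nu : R) : 0 <= nu -> tame (fun t => cosh (nu * t)).
Proof.
intros Hnu. destruct (INR_unbounded nu) as [N HN]. repeat split.
- intros t. apply (ex_derive_continuous (fun t => cosh (nu * t))). unfold cosh. auto_derive; auto.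
- intros t Ht. unfold cosh. pose proof (exp_pos (nu * t)). pose proof (exp_pos (- (nu * t))). lra.
- exists 1, N. split. lra. intros t Ht. rewrite Rmult_1_l. unfold cosh.
  assert (exp (nu * t) <= exp (INR N * t)) by (apply exp_le_exp; nra).
  assert (exp (- (nu * t)) <= exp (nu * t)) by (apply exp_le_exp; nra). lra.
Qed.

Lemma tame_sinh (nu : R) : 0 <= nu -> tame (fun t => sinh (nu * t)).
Proof.
intros Hnu. destruct (INR_unbounded nu) as [N HN]. repeat split.
- intros t. apply (ex_derive_continuous (fun t => sinh (nu * t))). unfold sinh. auto_derive; auto.
- intros t Ht. unfold sinh.
  assert (exp (- (nu * t)) <= exp (nu * t)) by (apply exp_le_exp; nra). lra.
- exists 1, N. split. lra. intros t Ht. rewrite Rmult_1_l. unfold sinh.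
  assert (exp (nu * t) <= exp (INR N * t)) by (apply exp_le_exp; nra).
  pose proof (exp_pos (- (nu * t))). pose proof (exp_pos (nu * t)). lra.
Qed.

Lemma tame_ext (f g : R -> R) : (forall t, f t = g t) -> tame f -> tame g.
Proof.
intros E (Cf & Pf & C & N & HC & Bf). repeat split.
- intros t. apply (continuous_ext f g); auto.
- intros t Ht. rewrite <- E; auto.
- exists C, N. split; auto. intros t Ht. rewrite <- E; auto.
Qed.

Lemma tame_cosh1 : tame cosh.
Proof. apply tame_ext with (2 := tame_cosh 1 ltac:(lra)). intros; f_equal; ring. Qed.

Lemma tame_sinh1 : tame sinh.
Proof. apply tame_ext with (2 := tame_sinh 1 ltac:(lra)). intros; f_equal; ring. Qed.

(** Since [cosh t >= exp t / 2], the estimate of [y^(N+1)] by [exp y] at [y = x cosh t] beats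
    [exp ((N+1) t)]: [N] powers absorb the weight and the last one leaves [exp (- t)]. *)
Lemma tame_exp_cosh_le (f : R -> R) (x : R) : tame f -> 0 < x ->
  exists C, 0 < C /\ forall t, 0 <= t -> exp (- x * cosh t) * f t <= C * exp (- t).
Proof.
intros (_ & Pf & D & N & HD & Bf) Hx.
assert (Hp : 0 < (x / 2) ^ (S N)) by (apply pow_lt; lra).
pose proof (INR_fact_lt_0 (S N)) as Hfa.
assert (H0 : 0 < INR (fact (S N)) / (x / 2) ^ (S N)) by (apply Rdiv_lt_0_compat; auto).
(* The summand 1 keeps the constant positive when [D = 0]. *)
exists (1 + D * (INR (fact (S N)) / (x / 2) ^ (S N))). split. nra.
intros t Ht. set (y := x * cosh t).
assert (Hy : x / 2 * exp t <= y).
{ unfold y, cosh. pose proof (exp_pos (- t)). nra. }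
pose proof (exp_pos t) as Het.
assert (Hy0 : 0 <= x / 2 * exp t) by nra.
assert (H1 : (x / 2 * exp t) ^ S N <= y ^ S N) by (apply pow_incr; split; lra).
pose proof (pow_le_fact_exp (S N) y ltac:(lra)) as H2.
rewrite Rpow_mult_distr in H1.
replace (exp t ^ S N) with (exp (INR N * t) * exp t) in H1.
2:{ rewrite <- exp_plus, <- (Rpower_pow (S N)) by auto. unfold Rpower.
    rewrite ln_exp, S_INR. f_equal; ring. }
replace (- x * cosh t) with (- y) by (unfold y; ring).
specialize (Bf t Ht). specialize (Pf t Ht).
pose proof (exp_pos (- y)) as Hey.
pose proof (exp_pos (- t)) as Hemt.
apply Rle_trans with (D * (exp (- y) * exp (INR N * t))).
{ replace (D * (exp (- y) * exp (INR N * t))) with (exp (- y) * (D * exp (INR N * t))) by ring.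
  apply Rmult_le_compat_l; lra. }
apply Rle_trans with (D * (INR (fact (S N)) / (x / 2) ^ S N * exp (- t))); [|nra].
apply Rmult_le_compat_l; auto.
apply Rmult_le_reg_r with ((x / 2) ^ S N * exp t * exp y).
{ pose proof (exp_pos y). apply Rmult_lt_0_compat; auto. apply Rmult_lt_0_compat; auto. }
replace (exp (- y) * exp (INR N * t) * ((x / 2) ^ S N * exp t * exp y))
  with ((x / 2) ^ S N * (exp (INR N * t) * exp t) * (exp (- y) * exp y)) by ring.
replace (INR (fact (S N)) / (x / 2) ^ S N * exp (- t) * ((x / 2) ^ S N * exp t * exp y))
  with (INR (fact (S N)) * exp y * (exp (- t) * exp t)) by (field; lra).
rewrite <- !(exp_plus (- _)), !Rplus_opp_l, exp_0, !Rmult_1_r. lra.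
Qed.

(** * The integral transform with kernel exp (- x cosh t) *)

(** [K_nu] and its derivatives in [x] are, up to sign, values of this one transform at different
    weights. *)
Definition cosh_laplace (f : R -> R) (x : R) : R :=
  RInt_gen (fun t => exp (- x * cosh t) * f t) (at_point 0) (Rbar_locally p_infty).

Lemma continuous_exp_cosh_mult (f : R -> R) (x t : R) :
  continuous f t -> continuous (fun t => exp (- x * cosh t) * f t) t.
Proof.
intros H. apply (continuous_mult (fun t => exp (- x * cosh t)) f); auto.
apply (ex_derive_continuous (fun t => exp (- x * cosh t))). unfold cosh. auto_derive; auto.
Qed.

Lemma is_RInt_gen_cosh_laplace (f : R -> R) (x : R) : tame f -> 0 < x ->
  is_RInt_gen (fun t => exp (- x * cosh t) * f t) (at_point 0) (Rbar_locally p_infty) (cosh_laplace f x)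
  /\ ((forall t, 0 < t -> 0 < f t) -> 0 < cosh_laplace f x).
Proof.
intros Tf Hx. destruct (tame_exp_cosh_le f x Tf Hx) as (C & HC & HB).
destruct Tf as (Cf & Pf & _).
destruct (is_RInt_gen_nonneg (at_point 0) (fun a => a = 0) (fun t => exp (- x * cosh t) * f t) C)
  as (l & Hl & Hle).
- apply at_point_filter.
- exists 0; auto.
- intros a0 ->. split; auto. lra.
- intros; lra.
- intros a t _ _. apply continuous_exp_cosh_mult; auto.
- intros a t -> Ht. apply Rmult_le_pos; auto. left; apply exp_pos.
- intros a b -> Hb.
  assert (I : is_RInt (fun t => C * exp (- t)) 0 b (- C * exp (- b) - - C * exp (- 0))).
  { apply (is_RInt_derive (fun t => - C * exp (- t))); intros t _.
    - auto_derive; auto. ring.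
    - apply (ex_derive_continuous (fun t => C * exp (- t))). auto_derive; auto. }
  apply Rle_trans with (- C * exp (- b) - - C * exp (- 0)).
  + rewrite <- (is_RInt_unique _ _ _ _ I). apply RInt_le. lra.
    * apply (ex_RInt_continuous (V := R_CompleteNormedModule)). intros; apply continuous_exp_cosh_mult; auto.
    * eexists; exact I.
    * intros t Ht. apply HB; lra.
  + rewrite Ropp_0, exp_0. pose proof (exp_pos (- b)). nra.
- assert (E : cosh_laplace f x = l) by (apply is_RInt_gen_unique; exact Hl).
  rewrite E. split; auto. intros Hp.
  apply Rlt_le_trans with (2 := Hle 0 1 eq_refl ltac:(lra)).
  apply RInt_gt_0. lra.
  + intros t Ht. apply Rmult_lt_0_compat. apply exp_pos. apply Hp; lra.
  + intros; apply continuous_exp_cosh_mult; auto.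
Qed.

Lemma filter_prod_0_infty (P : R * R -> Prop) :
  (forall b, 0 <= b -> P (0, b)) -> filter_prod (at_point 0) (Rbar_locally p_infty) P.
Proof.
intros H. exists (fun a => a = 0) (fun b => 0 <= b).
- reflexivity.
- exists 0; intros; lra.
- intros a b -> Hb. auto.
Qed.

Lemma is_RInt_gen_ext_eq (f g : R -> R) (l : R) :
  (forall t, f t = g t) ->
  is_RInt_gen f (at_point 0) (Rbar_locally p_infty) l ->
  is_RInt_gen g (at_point 0) (Rbar_locally p_infty) l.
Proof.
intros E. apply is_RInt_gen_ext. apply filter_prod_0_infty. intros; apply E.
Qed.

Lemma is_RInt_gen_cosh_laplace_of (f g : R -> R) (x l : R) :
  (forall t, exp (- x * cosh t) * f t = g t) ->
  is_RInt_gen g (at_point 0) (Rbar_locally p_infty) l -> cosh_laplace f x = l.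
Proof.
intros E H. apply is_RInt_gen_unique. revert H. apply is_RInt_gen_ext_eq. auto.
Qed.

Lemma cosh_laplace_plus (f g : R -> R) (x : R) : tame f -> tame g -> 0 < x ->
  cosh_laplace (fun t => f t + g t) x = cosh_laplace f x + cosh_laplace g x.
Proof.
intros Tf Tg Hx. destruct (is_RInt_gen_cosh_laplace f x Tf Hx) as [Hf _].
destruct (is_RInt_gen_cosh_laplace g x Tg Hx) as [Hg _].
eapply is_RInt_gen_cosh_laplace_of; [|exact (is_RInt_gen_plus _ _ _ _ Hf Hg)].
intros t. unfold plus; simpl; ring.
Qed.

Lemma exp_second_order (y : R) : 0 <= exp y - 1 - y <= y ^ 2 * exp (Rabs y).
Proof.
pose proof (exp_ineq1_le y) as H1. pose proof (exp_ineq1_le (- y)) as H2.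
split. lra.
assert (H3 : exp y * exp (- y) = 1) by (rewrite <- exp_plus, Rplus_opp_r, exp_0; auto).
pose proof (exp_pos y) as H4.
(* This is [exp (- y) >= 1 - y] multiplied by [exp y]. For [y >= 0] it bounds the remainder by
   [y (exp y - 1) <= y^2 exp y]; for [y < 0], [exp y >= 1 + y] enters as well. *)
assert (H5 : exp y - 1 <= y * exp y) by nra.
destruct (Rle_lt_dec 0 y) as [Hy|Hy].
- rewrite Rabs_pos_eq by auto. nra.
- rewrite Rabs_left by auto.
  assert (exp y - 1 - y <= y ^ 2) by nra.
  assert (1 <= exp (- y)) by lra. pose proof (pow2_ge_0 y). nra.
Qed.

(* The remainder of the difference quotient is integrated against [cosh t ^ 2] at [x/2]. *)
Lemma is_derive_cosh_laplace (f : R -> R) (x : R) : tame f -> 0 < x ->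
  is_derive (cosh_laplace f) x (- cosh_laplace (fun t => cosh t * f t) x).
Proof.
intros Tf Hx.
assert (Tf1 := tame_mult _ _ tame_cosh1 Tf).
assert (Tf2 := tame_mult _ _ tame_cosh1 Tf1).
destruct (is_RInt_gen_cosh_laplace f x Tf Hx) as [H0 _].
destruct (is_RInt_gen_cosh_laplace _ x Tf1 Hx) as [H1 _].
destruct (is_RInt_gen_cosh_laplace _ (x / 2) Tf2 ltac:(lra)) as [H2 _].
set (J1 := cosh_laplace (fun t => cosh t * f t) x) in *.
set (M := cosh_laplace (fun t => cosh t * (cosh t * f t)) (x / 2)) in *.
assert (key : forall h, Rabs h < x / 2 -> Rabs (cosh_laplace f (x + h) - cosh_laplace f x + h * J1) <= h ^ 2 * M).
{ intros h Hh. pose proof (Rabs_def2 _ _ Hh) as Hh'.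
  destruct (is_RInt_gen_cosh_laplace f (x + h) Tf ltac:(lra)) as [Hxh _].
  assert (L := is_RInt_gen_plus _ _ _ _ (is_RInt_gen_minus _ _ _ _ Hxh H0) (is_RInt_gen_scal _ h _ H1)).
  assert (L2 := is_RInt_gen_scal _ (h ^ 2) _ H2).
  refine (RInt_gen_norm _ _ _ _ _ _ L L2).
  - apply filter_prod_0_infty. auto.
  - apply filter_prod_0_infty. intros b Hb t [Ht _]. simpl in Ht.
    unfold norm, minus, plus, opp, scal; simpl; unfold abs, mult; simpl.
    destruct Tf as (_ & Pf & _). specialize (Pf t Ht).
    set (u := cosh t).
    assert (Hu : 0 < u) by (unfold u, cosh; pose proof (exp_pos t); pose proof (exp_pos (- t)); lra).
    replace (exp (- (x + h) * u) * f t + - (exp (- x * u) * f t) + h * (exp (- x * u) * (u * f t)))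
      with (exp (- x * u) * f t * (exp (- h * u) - 1 - - h * u)).
    2:{ replace (- (x + h) * u) with (- x * u + - h * u) by ring. rewrite exp_plus. ring. }
    destruct (exp_second_order (- h * u)) as [E1 E2].
    assert (P0 : 0 <= exp (- x * u) * f t) by (apply Rmult_le_pos; auto; left; apply exp_pos).
    rewrite Rabs_pos_eq by (apply Rmult_le_pos; auto).
    apply Rle_trans with (exp (- x * u) * f t * ((- h * u) ^ 2 * exp (x / 2 * u))).
    + apply Rmult_le_compat_l; auto. apply Rle_trans with (1 := E2).
      apply Rmult_le_compat_l. apply pow2_ge_0. apply exp_le_exp.
      rewrite Rabs_mult, Rabs_Ropp, (Rabs_pos_eq u) by lra. apply Rmult_le_compat_r; lra.
    + right. replace (- (x / 2) * u) with (- x * u + x / 2 * u) by field.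
      rewrite exp_plus. ring. }
apply is_derive_Reals. intros eps Heps.
(* The sign of [M] is read off from [key] at the admissible increment [x / 4]. *)
assert (HM : 0 <= M).
{ destruct (Req_dec M 0) as [->|_]; [lra|].
  specialize (key (x / 4)). rewrite Rabs_pos_eq in key by lra. specialize (key ltac:(lra)).
  pose proof (Rabs_pos (cosh_laplace f (x + x / 4) - cosh_laplace f x + x / 4 * J1)).
  assert (0 < (x / 4) ^ 2) by (apply pow_lt; lra). nra. }
assert (Hd : 0 < Rmin (x / 2) (eps / (M + 1))).
{ apply Rmin_glb_lt. lra. apply Rdiv_lt_0_compat; lra. }
exists (mkposreal _ Hd). intros h Hh0 Hh. simpl in Hh.
assert (Ha : Rabs h < x / 2) by (apply Rlt_le_trans with (1 := Hh); apply Rmin_l).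
assert (Hb : Rabs h < eps / (M + 1)) by (apply Rlt_le_trans with (1 := Hh); apply Rmin_r).
specialize (key h Ha).
replace ((cosh_laplace f (x + h) - cosh_laplace f x) / h - - J1)
  with ((cosh_laplace f (x + h) - cosh_laplace f x + h * J1) / h) by (field; auto).
assert (Hh1 := Rabs_pos_lt _ Hh0).
unfold Rdiv at 1. rewrite Rabs_mult, Rabs_inv.
apply Rmult_lt_reg_r with (Rabs h); auto.
rewrite Rmult_assoc, Rinv_l, Rmult_1_r by lra.
apply Rle_lt_trans with (1 := key). rewrite <- pow2_abs.
assert (Rabs h * (M + 1) < eps).
{ apply Rmult_lt_compat_r with (r := M + 1) in Hb; [|lra].
  replace (eps / (M + 1) * (M + 1)) with eps in Hb by (field; lra). auto. }
nra.
Qed.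

Lemma filterlim_tame_exp_cosh (f : R -> R) (x : R) : tame f -> 0 < x ->
  filterlim (fun t => exp (- x * cosh t) * f t) (Rbar_locally p_infty) (locally 0).
Proof.
intros Tf Hx. destruct (tame_exp_cosh_le f x Tf Hx) as (C & HC & HB).
destruct Tf as (_ & Pf & _).
apply filterlim_squeeze_0 with (fun t => C * exp (- t)) 0.
- intros t Ht. split. apply Rmult_le_pos. left; apply exp_pos. apply Pf; lra. apply HB; lra.
- replace (Finite 0) with (Rbar_mult C 0) by (simpl; f_equal; ring).
  apply is_lim_scal_l.
  apply (is_lim_comp exp Ropp p_infty 0 m_infty).
  + apply is_lim_exp_m.
  + apply (is_lim_opp (fun y => y) p_infty p_infty). apply is_lim_id.
  + exists 0. intros; discriminate.
Qed.

(* Integration by parts against the derivative [- x sinh t e^(-x cosh t)]. *)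
Lemma cosh_laplace_by_parts (f df g : R -> R) (x : R) :
  tame f -> (forall t, is_derive f t (df t)) -> f 0 = 0 -> tame df ->
  (forall t, g t = sinh t * f t) -> 0 < x ->
  x * cosh_laplace g x = cosh_laplace df x.
Proof.
intros Tf Hd Hf0 Tdf Hg Hx.
assert (Tg : tame g).
{ apply tame_ext with (fun t => sinh t * f t); auto. apply tame_mult; auto. apply tame_sinh1. }
destruct (is_RInt_gen_cosh_laplace g x Tg Hx) as [H0 _].
symmetry.
assert (H1 : is_RInt_gen (fun t => - x * (exp (- x * cosh t) * g t) + exp (- x * cosh t) * df t)
   (at_point 0) (Rbar_locally p_infty) (0 - 0)).
{ apply is_RInt_gen_derivative with (P := fun _ => True) (f := fun t => exp (- x * cosh t) * f t).
  - apply at_point_filter.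
  - apply Rbar_locally_filter.
  - apply filter_prod_0_infty; auto.
  - apply filter_prod_0_infty; auto.
  - intros t _. unfold cosh. specialize (Hd t). auto_derive.
    + eexists; exact Hd.
    + replace (Derive (fun x => f x) t) with (df t) by (symmetry; apply is_derive_unique; exact Hd).
      rewrite Hg. unfold sinh. unfold Rdiv; field.
  - intros t _. apply (continuous_plus (fun t => - x * (exp (- x * cosh t) * g t)) (fun t => exp (- x * cosh t) * df t)).
    + apply (continuous_mult (fun _ => - x)). apply continuous_const.
      apply continuous_exp_cosh_mult, Tg.
    + apply continuous_exp_cosh_mult, Tdf.
  - intros P HP. unfold filtermap, at_point. rewrite Hf0, Rmult_0_r. apply locally_singleton, HP.
  - apply filterlim_tame_exp_cosh; auto. }
assert (E := is_RInt_gen_plus _ _ _ _ (is_RInt_gen_scal _ x _ H0) H1).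
transitivity (plus (scal x (cosh_laplace g x)) (0 - 0)).
- eapply is_RInt_gen_cosh_laplace_of; [|exact E].
  intros t. unfold plus, scal; simpl; unfold mult; simpl; ring.
- unfold plus, scal; simpl; unfold mult; simpl; ring.
Qed.

(* [K_nu], [- K_nu'] and [K_nu'']. *)
Definition momentK0 (nu : R) : R -> R := cosh_laplace (fun t => cosh (nu * t)).
Definition momentK1 (nu : R) : R -> R := cosh_laplace (fun t => cosh t * cosh (nu * t)).
Definition momentK2 (nu : R) : R -> R := cosh_laplace (fun t => cosh t * (cosh t * cosh (nu * t))).

(** * Recurrence and differential equation of K *)

Lemma cosh_pos (t : R) : 0 < cosh t.
Proof. unfold cosh. pose proof (exp_pos t); pose proof (exp_pos (- t)); lra. Qed.

Lemma cosh_add (s t : R) : cosh (s + t) = cosh t * cosh s + sinh t * sinh s.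
Proof. unfold cosh, sinh. rewrite Ropp_plus_distr, !exp_plus. field. Qed.

Lemma sinh_sqr (t : R) : sinh t * sinh t + 1 = cosh t * cosh t.
Proof.
unfold cosh, sinh.
assert (H : exp t * exp (- t) = 1) by (rewrite <- exp_plus, Rplus_opp_r, exp_0; auto).
nra.
Qed.

Lemma cosh_laplace_scal (c : R) (f : R -> R) (x : R) : tame f -> 0 < x ->
  cosh_laplace (fun t => c * f t) x = c * cosh_laplace f x.
Proof.
intros Tf Hx. destruct (is_RInt_gen_cosh_laplace _ x Tf Hx) as [H _].
eapply is_RInt_gen_cosh_laplace_of; [|exact (is_RInt_gen_scal _ c _ H)].
intros t. unfold scal; simpl; unfold mult; simpl; ring.
Qed.

Lemma cosh_laplace_ext (f g : R -> R) (x : R) : tame f -> 0 < x -> (forall t, f t = g t) ->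
  cosh_laplace f x = cosh_laplace g x.
Proof.
intros Tf Hx E. symmetry. eapply is_RInt_gen_cosh_laplace_of.
2:{ apply is_RInt_gen_cosh_laplace; [exact Tf|exact Hx]. }
intros t. simpl. rewrite E. reflexivity.
Qed.

Lemma cosh_laplace_sinh_sinh (nu x : R) : 0 <= nu -> 0 < x ->
  x * cosh_laplace (fun t => sinh t * sinh (nu * t)) x = nu * momentK0 nu x.
Proof.
intros Hnu Hx.
assert (Tc := tame_cosh nu Hnu). assert (Ts := tame_sinh nu Hnu).
rewrite (cosh_laplace_by_parts (fun t => sinh (nu * t)) (fun t => nu * cosh (nu * t))); auto.
- apply cosh_laplace_scal; auto.
- intros t. unfold sinh, cosh. auto_derive; auto. field.
- rewrite Rmult_0_r. apply sinh_0.
- apply (tame_mult (fun _ => nu)); auto. apply tame_const; auto.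
Qed.

(** The addition formula splits [cosh ((nu + 1) t)], and its [sinh] product integrates by parts to
    [nu K_nu]. This is the recurrence [x K_(nu+1) = - x K_nu' + nu K_nu]. *)
Lemma besselK_succ (nu x : R) : 0 <= nu -> 0 < x ->
  x * besselK (nu + 1) x = x * momentK1 nu x + nu * momentK0 nu x.
Proof.
intros Hnu Hx.
assert (Tc := tame_cosh nu Hnu). assert (Ts := tame_sinh nu Hnu).
rewrite <- cosh_laplace_sinh_sinh, <- Rmult_plus_distr_l by auto. f_equal.
unfold momentK1. rewrite <- cosh_laplace_plus; auto using tame_mult, tame_cosh1, tame_sinh1.
apply cosh_laplace_ext; auto. apply tame_cosh; lra.
intros t. rewrite <- cosh_add. f_equal; ring.
Qed.

(** The modified Bessel equation. Writing [cosh^2 = 1 + sinh^2] in the second moment leaves a double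
    [sinh] factor, and each integration by parts removes one [sinh t] for one power of [x]. *)
Lemma besselK_ode (nu x : R) : 0 <= nu -> 0 < x ->
  x ^ 2 * momentK2 nu x = (x ^ 2 + nu ^ 2) * momentK0 nu x + x * momentK1 nu x.
Proof.
intros Hnu Hx.
assert (Tc := tame_cosh nu Hnu). assert (Ts := tame_sinh nu Hnu).
assert (T1 := tame_cosh1). assert (T2 := tame_sinh1).
assert (Tss := tame_mult _ _ T2 Ts). assert (Tcc := tame_mult _ _ T1 Tc).
assert (Tsc := tame_mult _ _ T2 (tame_mult _ _ T2 Tc)).
assert (E2 : momentK2 nu x = cosh_laplace (fun t => sinh t * (sinh t * cosh (nu * t))) x + momentK0 nu x).
{ unfold momentK2, momentK0. rewrite <- cosh_laplace_plus; auto.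
  apply cosh_laplace_ext; auto. apply tame_mult; auto.
  intros t. rewrite <- !Rmult_assoc, <- sinh_sqr. ring. }
assert (P1 : x * cosh_laplace (fun t => sinh t * sinh (nu * t)) x = nu * momentK0 nu x).
{ apply cosh_laplace_sinh_sinh; auto. }
assert (P2 : x * cosh_laplace (fun t => sinh t * (sinh t * cosh (nu * t))) x
  = momentK1 nu x + nu * cosh_laplace (fun t => sinh t * sinh (nu * t)) x).
{ rewrite (cosh_laplace_by_parts (fun t => sinh t * cosh (nu * t))
    (fun t => cosh t * cosh (nu * t) + nu * (sinh t * sinh (nu * t)))); auto.
  - assert (Tn := tame_mult _ _ (tame_const nu Hnu) Tss).
    rewrite cosh_laplace_plus, cosh_laplace_scal; auto.
  - apply tame_mult; auto.
  - intros t. unfold sinh, cosh. auto_derive; auto. field.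
  - rewrite sinh_0. ring.
  - apply tame_plus; auto. apply (tame_mult (fun _ => nu)); auto. apply tame_const; auto. }
rewrite E2. nra.
Qed.

Lemma momentK0_pos (nu x : R) : 0 <= nu -> 0 < x -> 0 < momentK0 nu x.
Proof.
intros Hnu Hx. apply is_RInt_gen_cosh_laplace; auto using tame_cosh. intros; apply cosh_pos.
Qed.

Lemma momentK1_pos (nu x : R) : 0 <= nu -> 0 < x -> 0 < momentK1 nu x.
Proof.
intros Hnu Hx. apply is_RInt_gen_cosh_laplace; auto using tame_cosh, tame_mult, tame_cosh1.
intros; apply Rmult_lt_0_compat; apply cosh_pos.
Qed.

Lemma ratioK_eq (nu x : R) : 0 <= nu -> 0 < x ->
  x * (besselK (nu + 1) x / besselK nu x) = nu + x * momentK1 nu x / momentK0 nu x.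
Proof.
intros Hnu Hx. pose proof (momentK0_pos nu x Hnu Hx) as H0.
change (besselK nu x) with (momentK0 nu x).
replace (x * (besselK (nu + 1) x / momentK0 nu x)) with (x * besselK (nu + 1) x / momentK0 nu x) by (field; lra).
rewrite besselK_succ by auto. field. lra.
Qed.

Lemma riccatiK (nu x : R) : 0 <= nu -> 0 < x ->
  let V := fun x => x * momentK1 nu x / momentK0 nu x in
  exists dV, is_derive V x dV /\ x * dV = V x ^ 2 - (nu ^ 2 + x ^ 2).
Proof.
intros Hnu Hx V. pose proof (momentK0_pos nu x Hnu Hx) as H0.
assert (D0 : is_derive (momentK0 nu) x (- momentK1 nu x)) by (apply is_derive_cosh_laplace; auto using tame_cosh).
assert (D1 : is_derive (momentK1 nu) x (- momentK2 nu x)).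
{ apply is_derive_cosh_laplace; auto using tame_cosh, tame_mult, tame_cosh1. }
exists ((momentK1 nu x - x * momentK2 nu x) / momentK0 nu x + x * momentK1 nu x ^ 2 / momentK0 nu x ^ 2). split.
- unfold V. auto_derive.
  + repeat split. eexists; exact D1. eexists; exact D0. lra.
  + replace (Derive (fun x => momentK0 nu x) x) with (- momentK1 nu x) by (symmetry; apply is_derive_unique; exact D0).
    replace (Derive (fun x => momentK1 nu x) x) with (- momentK2 nu x) by (symmetry; apply is_derive_unique; exact D1).
    field. lra.
- pose proof (besselK_ode nu x Hnu Hx) as E.
  replace (x * ((momentK1 nu x - x * momentK2 nu x) / momentK0 nu x + x * momentK1 nu x ^ 2 / momentK0 nu x ^ 2))
    with ((x * momentK1 nu x - x ^ 2 * momentK2 nu x) / momentK0 nu x + x ^ 2 * momentK1 nu x ^ 2 / momentK0 nu x ^ 2) by (field; lra).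
  rewrite E. unfold V. field. lra.
Qed.

(** * The bound for K *)

Lemma ratioK_bound (nu p x0 : R) : 0 <= p -> 0 < x0 -> 0 <= nu ->
  let a := (1 + p) ^ 2 / 2 in
  let n := nu - a in
  let c := n / (n + p ^ 2) in
  0 < n ->
  p * sqrt (n ^ 2 + c * x0 ^ 2) <> n ->
  nu + a + sqrt (n ^ 2 + c * x0 ^ 2) < x0 * (besselK (nu + 1) x0 / besselK nu x0).
Proof.
intros Hp Hx0 Hnu a n c Hn Hne. rewrite ratioK_eq by auto.
pose proof (pow2_ge_0 p) as Hpp.
assert (Hc : 0 < c) by (apply Rdiv_lt_0_compat; lra).
assert (Ha : 0 < a) by (unfold a; nra).
(* [k] is the slope of [r] at infinity; it serves both as the exponential rate and in the linear
   growth bound. *)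
set (k := sqrt c). assert (Hk : 0 < k) by (apply sqrt_lt_R0; auto).
assert (Hk2 : k ^ 2 = c) by (unfold k; rewrite pow2_sqrt; lra).
set (r := fun x => sqrt (n ^ 2 + c * x ^ 2)). fold (r x0) in Hne |- *.
assert (Hn2 : 0 < n ^ 2) by (apply pow_lt; auto).
assert (Hpos : forall x, 0 < x -> 0 < n ^ 2 + c * x ^ 2).
{ intros x Hx. assert (0 <= c * x ^ 2) by (apply Rmult_le_pos; [lra|apply pow2_ge_0]). lra. }
assert (Hr2 : forall x, 0 < x -> r x ^ 2 = n ^ 2 + c * x ^ 2).
{ intros x Hx. unfold r. rewrite pow2_sqrt; auto. left; auto. }
assert (Hr0 : forall x, 0 < x -> 0 < r x) by (intros x Hx; apply sqrt_lt_R0; auto).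
assert (Hrn : forall x, 0 < x -> n < r x).
{ intros x Hx. specialize (Hr2 x Hx). specialize (Hr0 x Hx).
  assert (0 < c * x ^ 2) by (apply Rmult_lt_0_compat; auto; apply pow_lt; auto). nra. }
assert (Hrk : forall x, 0 < x -> k * x <= r x <= n + k * x).
{ intros x Hx. specialize (Hr2 x Hx). specialize (Hr0 x Hx). rewrite <- Hk2 in Hr2.
  assert (0 < k * x) by (apply Rmult_lt_0_compat; auto).
  replace (k ^ 2 * x ^ 2) with ((k * x) ^ 2) in Hr2 by ring. split; nra. }
set (V := fun x => x * momentK1 nu x / momentK0 nu x).
assert (HV : forall x, 0 < x -> 0 < V x).
{ intros x Hx. apply Rdiv_lt_0_compat; [apply Rmult_lt_0_compat|]; auto using momentK0_pos, momentK1_pos. }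
set (w := fun x => V x - (a + r x)).
set (dw := fun x => Derive V x - c * x / r x).
assert (Hdw : forall x, 0 < x ->
  x * dw x = w x * (V x + (a + r x)) - (r x - n) * (p * r x - n) ^ 2 / (n * r x)).
{ intros x Hx. specialize (Hr0 x Hx). specialize (Hr2 x Hx).
  destruct (riccatiK nu x Hnu Hx) as (dV & Hd & E). fold V in Hd, E.
  unfold dw. rewrite (is_derive_unique _ _ _ Hd).
  rewrite <- (riccati_defect_minus a n p (r x) (x ^ 2)); try lra.
  - replace (x * (dV - c * x / r x)) with (x * dV - c * x ^ 2 / r x) by (field; lra).
    rewrite E. change (x * momentK1 nu x / momentK0 nu x) with (V x). rewrite Hr2. unfold w, n. field. lra.
  - unfold a. field.
  - rewrite Hr2. unfold c. field. lra. }
assert (HD : forall x, 0 < x -> 0 <= (r x - n) * (p * r x - n) ^ 2 / (n * r x)).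
{ intros x Hx. specialize (Hr0 x Hx). specialize (Hrn x Hx).
  apply Rdiv_le_0_compat; [|nra]. apply Rmult_le_pos; [lra|apply pow2_ge_0]. }
enough (0 < w x0) by (unfold w, V in *; lra).
apply positive_from_infinity with dw k (nu + k); auto.
- intros x Hx. assert (Hx' : 0 < x) by lra.
  destruct (riccatiK nu x Hnu Hx') as (dV & Hd & E). fold V in Hd.
  unfold w, dw. apply (is_derive_minus V (fun x => a + r x)).
  + rewrite (is_derive_unique _ _ _ Hd). exact Hd.
  + specialize (Hr0 x Hx'). unfold r in *. auto_derive.
    * specialize (Hpos x Hx'). simpl in Hpos. exact Hpos.
    * simpl in *. field. lra.
- intros x Hx Hw. assert (Hx' : 0 < x) by lra.
  specialize (Hdw x Hx'). specialize (HD x Hx'). specialize (Hrk x Hx'). specialize (HV x Hx').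
  (* The factor [V + a + r] is at least [k x], so for negative [w] division by [x] leaves the rate
     [k]. *)
  assert (w x * (V x + (a + r x)) <= w x * (k * x)) by nra.
  apply Rmult_le_reg_l with x; auto. lra.
(* From [V > 0] and [r <= n + k x] follows [w >= - (a + n + k x) = - (nu + k x)]. *)
- intros x Hx. assert (Hx' : 0 < x) by lra. specialize (Hrk x Hx'). specialize (HV x Hx').
  unfold w. unfold n in Hrk. nra.
- intros Hw. specialize (Hdw x0 Hx0). rewrite Hw in Hdw. specialize (Hrn x0 Hx0). specialize (Hr0 x0 Hx0).
  assert (0 < (r x0 - n) * (p * r x0 - n) ^ 2 / (n * r x0)).
  { apply Rdiv_lt_0_compat; [|nra]. apply Rmult_lt_0_compat; [lra|]. apply pow2_gt_0. lra. }
  nra.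
Qed.

(** The condition [2 <= nu] enters through [a < 2], which follows from [p < 1] and makes [n]
    positive. The excluded equality would force [n (n + p^2) = nu^2], although both factors are
    below [nu] because [p^2 < a]. *)
Lemma ratioK_lower (nu x : R) : 2 <= nu -> 0 < x ->
  let p := p_of nu x in
  nu + (1 + p) ^ 2 / 2 + sqrt ((nu - (1 + p) ^ 2 / 2) ^ 2 + c_minus nu p * x ^ 2)
  < x * (besselK (nu + 1) x / besselK nu x).
Proof.
intros Hnu Hx p. pose proof (p_of_bounds nu x ltac:(lra) Hx) as Hp. pose proof (p_of_sqr nu x Hx) as Hp2.
fold p in Hp, Hp2.
set (a := (1 + p) ^ 2 / 2).
assert (Hap : p ^ 2 < a) by (unfold a; nra).
assert (Ha2 : a < 2) by (unfold a; nra).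
pose proof (pow2_ge_0 p) as Hpp.
assert (E : c_minus nu p = (nu - a) / (nu - a + p ^ 2)).
{ unfold c_minus, a. unfold a in Ha2. field. simpl in *; lra. }
rewrite E. apply ratioK_bound; fold a; try lra.
set (n := nu - a). assert (Hn : 0 < n) by (unfold n; lra).
intros Ht.
assert (Hs : 0 <= n / (n + p ^ 2) * x ^ 2).
{ apply Rmult_le_pos. apply Rdiv_le_0_compat; lra. apply pow2_ge_0. }
assert (H1 : p ^ 2 * (n ^ 2 + n / (n + p ^ 2) * x ^ 2) = n ^ 2).
{ transitivity ((p * sqrt (n ^ 2 + n / (n + p ^ 2) * x ^ 2)) ^ 2); [|rewrite Ht; reflexivity].
  rewrite Rpow_mult_distr, pow2_sqrt; auto. pose proof (pow2_ge_0 n); lra. }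
assert (H2 : p ^ 2 * x ^ 2 = n * (1 - p ^ 2) * (n + p ^ 2)).
{ apply Rmult_eq_reg_l with (n / (n + p ^ 2)).
  - transitivity (n ^ 2 * (1 - p ^ 2)). lra. field. lra.
  - assert (0 < n / (n + p ^ 2)) by (apply Rdiv_lt_0_compat; lra). lra. }
assert (H3 : (1 - p ^ 2) * (n * (n + p ^ 2) - nu ^ 2) = 0) by lra.
assert (0 < 1 - p ^ 2) by nra.
assert (n * (n + p ^ 2) - nu ^ 2 = 0) by nra.
unfold n in *. nra.
Qed.

Theorem theorem8 :
  (forall nu x : R, 0 <= nu -> 0 < x ->
     let p := p_of nu x in
     x * (besselI (nu - 1) x / besselI nu x)
     < nu - (1 + p) ^ 2 / 2
       + sqrt ((nu + (1 + p) ^ 2 / 2) ^ 2 + c_plus nu p * x ^ 2))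
  /\
  (forall nu x : R, 2 <= nu -> 0 < x ->
     let p := p_of nu x in
     x * (besselK (nu + 1) x / besselK nu x)
     > nu + (1 + p) ^ 2 / 2
       + sqrt ((nu - (1 + p) ^ 2 / 2) ^ 2 + c_minus nu p * x ^ 2)).
Proof.
split; [exact ratioI_upper|exact ratioK_lower].
Qed.
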